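(* Let $f:\mathbb{R}^d\to\mathbb{R}$ be continuously differentiable with $L$-Lipschitz continuous gradient, and let $f^*=\min_{x\in\mathbb{R}^d}f(x)$. Let $\delta_1>0$, $\epsilon_S\in(0,3/4)$, $l\in\mathbb{N}^+$ be such that $$\delta_S<\frac{c}{(c+1)^2},\qquad \left[(1-\delta_S)(1-\delta_1)-1+\frac{c}{(c+1)^2}\right]^{-1}>0,$$ where $\delta_S=e^{-\frac{l(\epsilon_S-1/4)^2}{C_3}}$ and $C_3$ is the stable $1$-hashing embedding constant specified in the context. Apply the random-subspace trust region algorithm described in the context to $f$, where $\|B_k\|_2\le B_{\max}$ for all $k$ and some constant $B_{\max}\ge0$, and where $\mathcal S$ is the distribution of $l\times d$ stable $1$-hashing matrices. Let $\epsilon>0$ and suppose the algorithm runs for $N$ iterations with $$N\ \ge\ \left[(1-\delta_S)(1-\delta_1)-1+\frac{c}{(c+1)^2}\right]^{-1}\left[\frac{f(x_0)-f^*}{h(\epsilon,\alpha_0\gamma_1^{c+\tau_\alpha})}+\frac{\tau_\alpha}{1+c}\right],$$ where $$h(\epsilon,\alpha_0\gamma_1^{c+\tau_\alpha})=\theta C_7(1-\epsilon_S)\epsilon^2\gamma_1^{c+1}\min\left\{\frac{C_7(1-\theta)}{(L+\frac12B_{\max})\lceil d/l\rceil},\ \frac1{B_{\max}},\ \frac{\alpha_0}{(1-\epsilon_S)^{1/2}\epsilon\gamma_2}\right\}$$ and $\tau_\alpha=\left\lceil\log_{\gamma_1}\left(\min\{\alpha_{low}/\alpha_0,\,1/\gamma_2\}\right)\right\rceil$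 with $\alpha_{low}=(1-\epsilon_S)^{1/2}\epsilon\min\left(\frac{C_7(1-\theta)}{(L+\frac12B_{\max})\lceil d/l\rceil},\frac1{B_{\max}}\right)$. Then $$\mathbb{P}(N\ge N_\epsilon)\ \ge\ 1-e^{-\frac{\delta_1^2}{2}(1-\delta_S)N},$$ where $N_\epsilon=\inf\{M:\min_{k\le M}\|\nabla f(x_k)\|_2\le\epsilon\}$.
   Context: Stable $1$-hashing matrix: for $l<d$ in $\mathbb{N}^+$, a random matrix $S\in\mathbb{R}^{l\times d}$ with exactly one non-zero per column, whose value is $\pm1$ with equal probability (independent signs), the row indices of the non-zeros being given by a sequence $\mathcal I$ constructed as follows: repeat the set $\{1,\dots,l\}$ $\lceil d/l\rceil$ times to obtain a multiset $D$, then randomly sample $d$ elements from $D$ without replacement to form $\mathcal I$. Constant $C_3$: $C_3>0$ is a problem-independent constant for which the $l\times d$ stable $1$-hashing distribution satisfies, for every fixed $y\in\{\nabla f(x):x\in\mathbb{R}^d\}$, $\mathbb{P}\left(\|Sy\|_2^2\ge(1-\epsilon_S)\|y\|_2^2\right)\ge1-e^{-l(\epsilon_S-1/4)^2/C_3}$ (whenever $e^{-l(\epsilon_S-1/4)^2/C_3}\in(0,1/2)$). Random-subspace trust region algorithm. Choose a distribution $\mathcal S$ of random matrices in $\mathbb{R}^{l\times d}$, and constants $\gamma_1\in(0,1)$, $\gamma_2=\gamma_1^{-c}$ for some $c\in\mathbb{N}^+$ (positive integers), $\theta\in(0,1)$, $\alpha_{\max}>0$, a starting point $x_0\in\mathbb{R}^d$,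 and $\alpha_0=\alpha_{\max}\gamma_1^p$ for some $p\in\mathbb{N}^+$. For $k=0,1,\dots$: (1) Draw $S_k\in\mathbb{R}^{l\times d}$ from $\mathcal S$ (independently of all previous iterations) and let $\hat m_k(\hat s)=f(x_k)+\langle S_k\nabla f(x_k),\hat s\rangle+\frac12\langle\hat s,S_kB_kS_k^T\hat s\rangle$, where $B_k\in\mathbb{R}^{d\times d}$ is a user-chosen positive semi-definite matrix ($B_k=0$ is allowed). Compute $\hat s_k\in\mathbb{R}^l$ by approximately minimising $\hat m_k$ such that, for some constant $C_7>0$ (independent of $k$), $\|\hat s_k\|_2\le\alpha_k$ and $\hat m_k(0)-\hat m_k(\hat s_k)\ge C_7\|S_k\nabla f(x_k)\|_2\min\left\{\alpha_k,\frac{\|S_k\nabla f(x_k)\|_2}{\|B_k\|_2}\right\}$. Set $s_k=S_k^T\hat s_k$. (2) Check the sufficient decrease condition $f(x_k)-f(x_k+s_k)\ge\theta[\hat m_k(0)-\hat m_k(\hat s_k)]$. (3) If it holds, set $x_{k+1}=x_k+s_k$, $\alpha_{k+1}=\min\{\alpha_{\max},\gamma_2\alpha_k\}$ (successful); otherwise $x_{k+1}=x_k$, $\alpha_{k+1}=\gamma_1\alpha_k$ (unsuccessful). Convention: quotients with denominator $\|B_k\|_2=0$ or $B_{\max}=0$ are read as $+\infty$ inside the minima. *)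

(* Defs.v *)
From HB Require Import structures.
From mathcomp Require Export all_boot all_order all_algebra.
From mathcomp Require Export all_classical all_reals all_analysis.
Export numFieldNormedType.Exports.

Set Implicit Arguments.
Unset Strict Implicit.
Unset Printing Implicit Defensive.

Import Order.TTheory GRing.Theory Num.Theory.

Local Open Scope classical_set_scope.
Local Open Scope ring_scope.

(* The norm that MathComp-Analysis puts on matrices is the max norm (it gives
   the same topology and derivatives); all norms below are explicit. *)

Definition dotv {R : realType} {n : nat} (u v : 'cV[R]_n) : R :=
  \sum_(i < n) u i 0 * v i 0.

Definition norm2 {R : realType} {n : nat} (u : 'cV[R]_n) : R :=
  Num.sqrt (dotv u u).

(* Spectral norm, as the operator norm induced by norm2. *)
Definition opnorm2 {R : realType} {m n : nat} (A : 'M[R]_(m, n)) : R :=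
  sup [set norm2 (A *m v) | v in [set v : 'cV[R]_n | norm2 v <= 1]].

Definition psdmx {R : realType} {n : nat} (B : 'M[R]_n) : Prop :=
  B^T = B /\ forall v : 'cV[R]_n, 0 <= dotv v (B *m v).

(* Quotients with denominator 0 are +oo, for use inside minima. *)
Definition xdiv {R : realType} (a b : R) : \bar R :=
  if b == 0 then +oo%E else (a / b)%:E.

Definition ceil_divn (d l : nat) : nat := (d %/ l + ~~ (l %| d))%N.

Section Gradient.
Variables (R : realType) (d : nat).
Implicit Types f : 'cV[R]_d -> R.

Definition gradient f (x : 'cV[R]_d) : 'cV[R]_d :=
  \col_(i < d) 'D_(delta_mx i 0) f x.

Definition continuously_differentiable f : Prop :=
  (forall x, differentiable f x) /\ continuous (gradient f).

Definition lipschitz_gradient (L : R) f : Prop :=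
  forall x y, norm2 (gradient f x - gradient f y) <= L * norm2 (x - y).

Definition is_minimum_value f (m : R) : Prop :=
  (exists x, f x = m) /\ forall x, m <= f x.

End Gradient.

Section StableHashing.
Variables (R : realType) (l d : nat).

(* A seed is a pair (u, sgn). An element of the multiset D is a pair (r, a): the
   a-th copy of the row index r. Drawing d elements of D without replacement is
   drawing uniformly an injective u : 'I_d -> D, and sgn j is the sign of the
   non-zero of column j. *)
Definition hashing_seed : Type :=
  ({ffun 'I_d -> 'I_l * 'I_(ceil_divn d l)} * {ffun 'I_d -> bool})%type.

Definition hashing_seeds : {set hashing_seed} :=
  [set q : hashing_seed | injectiveb q.1].

Definition hashing_mx (q : hashing_seed) : 'M[R]_(l, d) :=
  \matrix_(i < l, j < d) if (q.1 j).1 == i then (-1) ^+ q.2 j else 0.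

(* Probability that an l x d stable 1-hashing matrix belongs to A: the image by
   hashing_mx of the uniform distribution on hashing_seeds. *)
Definition stable_hashing (A : set 'M[R]_(l, d)) : R :=
  #|[set q in hashing_seeds | `[< A (hashing_mx q) >]]|%:R
  / #|hashing_seeds|%:R.

Definition delta_hashing (C3 epsS : R) : R :=
  expR (- (l%:R * (epsS - 4^-1) ^+ 2 / C3)).

Definition hashing_embedding (f : 'cV[R]_d -> R) (C3 epsS : R) : Prop :=
  0 < delta_hashing C3 epsS < 2^-1 ->
  forall y, range (gradient f) y ->
    stable_hashing
      [set S | (1 - epsS) * norm2 y ^+ 2 <= norm2 (S *m y) ^+ 2]
    >= 1 - delta_hashing C3 epsS.

End StableHashing.
Arguments stable_hashing {R l d} A.

Section TrustRegion.
Variables (R : realType) (l d : nat) (f : 'cV[R]_d -> R).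

Definition model (x : 'cV[R]_d) (S : 'M[R]_(l, d)) (B : 'M[R]_d)
    (s : 'cV[R]_l) : R :=
  f x + dotv (S *m gradient f x) s + 2^-1 * dotv s (S *m B *m S^T *m s).

Definition model_decrease x S B s : R := model x S B 0 - model x S B s.

Definition acceptable_step (C7 : R) x alpha S B s : Prop :=
  norm2 s <= alpha /\
  ((C7 * norm2 (S *m gradient f x))%:E
     * Order.min alpha%:E (xdiv (norm2 (S *m gradient f x)) (opnorm2 B))
   <= (model_decrease x S B s)%:E)%E.

Definition sufficient_decrease (theta : R) x S B s : bool :=
  theta * model_decrease x S B s <= f x - f (x + S^T *m s).

Variables (gamma1 gamma2 theta alphamax C7 : R).
Variables (disp : measure_display) (Omega : measurableType disp).
Variable P : probability Omega R.

(* The trajectory of the algorithm. The choices B and shat may be random and may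
   depend on the whole past and on the current sketching matrix. *)
Variables (x : nat -> Omega -> 'cV[R]_d) (alpha : nat -> Omega -> R).
Variables (S : nat -> Omega -> 'M[R]_(l, d)) (B : nat -> Omega -> 'M[R]_d).
Variable shat : nat -> Omega -> 'cV[R]_l.

Definition random_element (T : ptopologicalType) (X : Omega -> T) : Prop :=
  measurable_fun setT (X : Omega -> g_sigma_algebraType (@open T)).

Definition open_preimages (T : topologicalType) (X : Omega -> T) :
    set (set Omega) :=
  [set X @^-1` U | U in @open T].

(* The sigma-algebra of the iterations before iteration k, the iterate x k and
   the radius alpha k that they produce included. *)
Definition history (k : nat) : set (set Omega) :=
  <<s (\bigcup_(j in [set j | (j < k)%N])
         (open_preimages (S j) `|` open_preimages (B j)
          `|` open_preimages (shat j)))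
      `|` (\bigcup_(j in [set j | (j <= k)%N])
         (open_preimages (x j) `|` open_preimages (alpha j))) >>.

Record trust_region_run (x0 : 'cV[R]_d) (alpha0 : R) : Prop := {
  run_random : forall k, [/\ random_element (x k), random_element (alpha k),
    random_element (S k), random_element (B k) & random_element (shat k)];
  run_law : forall k A, <<s @open 'M[R]_(l, d) >> A ->
    P (S k @^-1` A) = (stable_hashing A)%:E;
  run_indep : forall k A H, <<s @open 'M[R]_(l, d) >> A -> history k H ->
    P (S k @^-1` A `&` H) = (P (S k @^-1` A) * P H)%E;
  run_init : forall w, x 0%N w = x0 /\ alpha 0%N w = alpha0;
  run_psd : forall k w, psdmx (B k w);
  run_step : forall k w,
    acceptable_step C7 (x k w) (alpha k w) (S k w) (B k w) (shat k w);
  run_update : forall k w,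
    if sufficient_decrease theta (x k w) (S k w) (B k w) (shat k w)
    then x k.+1 w = x k w + (S k w)^T *m shat k w /\
         alpha k.+1 w = Num.min alphamax (gamma2 * alpha k w)
    else x k.+1 w = x k w /\ alpha k.+1 w = gamma1 * alpha k w
}.

(* N_epsilon, equal to +oo when the gradient norm never gets below eps. *)
Definition hitting_time (eps : R) (w : Omega) : \bar R :=
  ereal_inf [set (M%:R)%:E | M in [set M : nat |
    \big[Num.min/norm2 (gradient f (x 0%N w))]_(k < M.+1)
      norm2 (gradient f (x k w)) <= eps]].

End TrustRegion.

Section Bound.
Variables (R : realType) (l d c : nat).
Variables (L Bmax theta C7 epsS eps gamma1 gamma2 alpha0 : R).

Definition alpha_ratio : \bar R :=
  xdiv (C7 * (1 - theta)) ((L + 2^-1 * Bmax) * (ceil_divn d l)%:R).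

Definition alpha_low : \bar R :=
  ((Num.sqrt (1 - epsS) * eps)%:E * Order.min alpha_ratio (xdiv 1 Bmax))%E.

(* In the two definitions below the minimum is finite, so fine is harmless. *)
Definition tau_alpha : int :=
  Num.ceil (ln (fine (Order.min (alpha_low * (alpha0^-1)%:E)%E (gamma2^-1)%:E))
            / ln gamma1).

(* h (eps, alpha0 * gamma1 ^ (c + tau_alpha)) *)
Definition h_bound : R :=
  theta * C7 * (1 - epsS) * eps ^+ 2 * gamma1 ^+ c.+1
  * fine (Order.min (Order.min alpha_ratio (xdiv 1 Bmax))
                    (alpha0 / (Num.sqrt (1 - epsS) * eps * gamma2))%:E).

End Bound.

Definition rate {R : realType} (c : nat) (deltaS delta1 : R) : R :=
  (1 - deltaS) * (1 - delta1) - 1 + c%:R / c.+1%:R ^+ 2.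

(* Main.v *)
Require Import Defs.
From mathcomp Require Import ring lra zify.

(** Call an iteration true when the drawn sketch preserves the norm of the
    current gradient up to the factor 1 - epsS, and false otherwise.  The proof
    plays a pathwise upper bound on the number of true iterations against a
    probabilistic lower bound.

    Pathwise, suppose that none of the first N gradients has norm at most eps.
    A true iteration with a small radius succeeds
    ([small_radius_sufficient_decrease]): the decrease of the model is
    proportional to the radius, whereas the error of the model is quadratic in
    it.  A true successful iteration whose radius is not too small decreases f
    by at least h ([good_success_decrease]), so there are at most
    (f x0 - fstar) / h of them.  The radius is alphamax times a power of gamma1,
    and every other true iteration moves the exponent towards the one from which
    on true iterations succeed.  Only false iterations and the true successful
    ones just counted can push the exponent away, by at most c each, so that
    every one of them pays for c + 1 iterations, itself included
    ([leq_iterations]).  Hence at least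
    N / (c + 1) - (f x0 - fstar) / h - tau / (c + 1) iterations are false
    ([true_iterations_le]).

    Probabilistically, given the past an iteration is true with probability at
    least 1 - deltaS, because the sketch is independent of the iterate and
    takes finitely many values ([true_iteration_likely]).  The lower-tail
    Chernoff bound for such dependent trials ([chernoff_lower_tail]) makes it
    unlikely that at most (1 - delta1) (1 - deltaS) N of the first N iterations
    are true.  The assumed lower bound on N says that, outside of this unlikely
    event, the pathwise bound is violated, since 1 / (c + 1) >= c / (c + 1)^2;
    so some gradient has norm at most eps. *)

Set Implicit Arguments.
Unset Strict Implicit.
Unset Printing Implicit Defensive.

Import Order.TTheory GRing.Theory Num.Theory.

Local Open Scope classical_set_scope.
Local Open Scope ring_scope.

(** * Euclidean norm and the descent inequality *)

Section Euclidean.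
Variables (R : realType) (n : nat).
Implicit Types u v w : 'cV[R]_n.

Lemma dotvC u v : dotv u v = dotv v u.
Proof. by apply: eq_bigr => i _; rewrite mulrC. Qed.

Lemma dotvDl u v w : dotv (u + v) w = dotv u w + dotv v w.
Proof. by rewrite -big_split; apply: eq_bigr => i _; rewrite mxE mulrDl. Qed.

Lemma dotvZl a u v : dotv (a *: u) v = a * dotv u v.
Proof. by rewrite mulr_sumr; apply: eq_bigr => i _; rewrite mxE mulrA. Qed.

Lemma dotvNl u v : dotv (- u) v = - dotv u v.
Proof. by rewrite -scaleN1r dotvZl mulN1r. Qed.

Lemma dotvDr u v w : dotv u (v + w) = dotv u v + dotv u w.
Proof. by rewrite dotvC dotvDl !(dotvC u). Qed.

Lemma dotvZr a u v : dotv u (a *: v) = a * dotv u v.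
Proof. by rewrite dotvC dotvZl dotvC. Qed.

Lemma dotv0 u : dotv u 0 = 0.
Proof. by rewrite -(scale0r 0) dotvZr mul0r. Qed.

Lemma dotv_ge0 u : 0 <= dotv u u.
Proof. by apply: sumr_ge0 => i _; rewrite -expr2 sqr_ge0. Qed.

Lemma dotvE u v : dotv u v = (u^T *m v) 0 0.
Proof. by rewrite mxE; apply: eq_bigr => i _; rewrite mxE. Qed.

Lemma norm2_ge0 u : 0 <= norm2 u.
Proof. exact: sqrtr_ge0. Qed.

Lemma sqr_norm2 u : norm2 u ^+ 2 = dotv u u.
Proof. by rewrite sqr_sqrtr ?dotv_ge0. Qed.

Lemma norm2Z a u : norm2 (a *: u) = `|a| * norm2 u.
Proof.
by rewrite /norm2 dotvZl dotvZr mulrA -expr2 sqrtrM ?sqr_ge0 // sqrtr_sqr.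
Qed.

Lemma norm2_eq0 u : norm2 u = 0 -> u = 0.
Proof.
move=> u0; have uu0 : dotv u u = 0 by rewrite -sqr_norm2 u0 expr2 mul0r.
apply/colP => i; rewrite mxE; apply/eqP; rewrite -sqrf_eq0 eq_le sqr_ge0 -uu0.
rewrite /dotv (bigD1 i) //= expr2 andbT lerDl sumr_ge0 // => j _.
by rewrite -expr2 sqr_ge0.
Qed.

Lemma dotv_le_norm2 u v : dotv u v <= norm2 u * norm2 v.
Proof.
have [/norm2_eq0 ->|u_neq0] := eqVneq (norm2 u) 0.
  by rewrite dotvC dotv0 mulr_ge0 ?norm2_ge0.
have [/norm2_eq0 ->|v_neq0] := eqVneq (norm2 v) 0.
  by rewrite dotv0 mulr_ge0 ?norm2_ge0.
have u_gt0 : 0 < norm2 u by rewrite lt_def u_neq0 norm2_ge0.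
have v_gt0 : 0 < norm2 v by rewrite lt_def v_neq0 norm2_ge0.
have := dotv_ge0 (norm2 v *: u + - norm2 u *: v).
rewrite !(dotvDl, dotvDr, dotvZl, dotvZr) -!sqr_norm2 (dotvC v u) => h.
rewrite -(ler_pM2l (mulr_gt0 u_gt0 v_gt0)); nra.
Qed.

End Euclidean.

Lemma dotv_mulmxl (R : realType) m n (A : 'M[R]_(m, n)) u v :
  dotv (A *m u) v = dotv u (A^T *m v).
Proof. by rewrite !dotvE trmx_mul mulmxA. Qed.

Section Descent.
Variables (R : realType) (d : nat) (f : 'cV[R]_d -> R).

Lemma derive_gradient x v :
  differentiable f x -> 'D_v f x = dotv (gradient f x) v.
Proof.
move=> df; rewrite deriveE //.
have -> : v = \sum_(i < d) v i 0 *: delta_mx i 0.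
  by rewrite {1}[v]matrix_sum_delta; apply: eq_bigr => i _; rewrite big_ord1.
rewrite linear_sum /dotv; apply: eq_bigr => i _.
rewrite linearZ /= -deriveE // mxE mulrC; congr (_ * _).
rewrite summxE (bigD1 i) //= !mxE !eqxx /= mulr1 big1 ?addr0 // => j ji.
by rewrite !mxE eq_sym (negbTE ji) mulr0.
Qed.

(** The mean value theorem gives the constant L instead of the sharp L / 2 that
    an integral would give; the threshold [alpha_ratio] leaves room for it. *)
Lemma descent_bound L x v : 0 <= L -> continuously_differentiable f ->
  lipschitz_gradient L f ->
  f (x + v) <= f x + dotv (gradient f x) v + L * dotv v v.
Proof.
move=> L0 [df _] lip.
pose phi (t : R) := f (x + t *: v).
have dphi (t : R) :
    is_derive t (1 : R) phi (dotv (gradient f (x + t *: v)) v).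
  have quotE : (fun h : R => h^-1 *: (phi (h *: 1 + t) - phi t)) =
      (fun h : R => h^-1 *: (f (h *: v + (x + t *: v)) - f (x + t *: v))).
    apply/funext => h; rewrite /phi; congr (_ *: (f _ - _)).
    by rewrite -[h *: 1]/(h * 1) mulr1 scalerDl addrCA.
  apply: DeriveDef.
    rewrite /derivable quotE; apply: diff_derivable; exact: df.
  by rewrite /derive quotE -derive_gradient.
have cphi : {within `[0, 1], continuous phi}.
  apply: continuous_subspaceT => t; apply: differentiable_continuous.
  by apply/derivable1_diffP; case: (dphi t).
have [t] := MVT_segment ler01 (fun t _ => dphi t) cphi.
rewrite in_itv /= /phi => /andP[t0 t1].
rewrite scale1r scale0r addr0 subr0 mulr1 => /eqP.
rewrite subr_eq => /eqP ->; rewrite addrC -addrA lerD2l.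
rewrite -lerBlDl.
have -> : dotv (gradient f (x + t *: v)) v - dotv (gradient f x) v =
   dotv (gradient f (x + t *: v) - gradient f x) v.
  by rewrite dotvDl dotvNl.
apply: le_trans (dotv_le_norm2 _ _) _.
have := lip (x + t *: v) x; rewrite addrAC subrr add0r norm2Z ger0_norm // => h.
apply: le_trans (ler_wpM2r (norm2_ge0 v) h) _.
rewrite -sqr_norm2 -!mulrA ler_wpM2l // -expr2.
by rewrite -[leRHS]mul1r ler_wpM2r ?sqr_ge0.
Qed.

End Descent.

(** * Norm of the transpose of a hashing matrix *)

Section HashingNorm.
Variables (R : realType) (l d : nat).
Implicit Types q : hashing_seed l d.

Lemma hashing_trmx_mul q (s : 'cV[R]_l) j :
  ((hashing_mx R q)^T *m s) j 0 = (-1) ^+ q.2 j * s (q.1 j).1 0.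
Proof.
rewrite mxE (bigD1 (q.1 j).1) //= !mxE eqxx big1 ?addr0 // => i ij.
by rewrite !mxE eq_sym (negbTE ij) mul0r.
Qed.

(** The columns whose non-zero lies in row i use distinct copies of i. *)
Lemma card_hashing_row q i : q \in hashing_seeds l d ->
  (#|[pred j | (q.1 j).1 == i]| <= ceil_divn d l)%N.
Proof.
rewrite inE => /injectiveP inj_q.
rewrite -[leqRHS]card_ord.
rewrite -(card_in_imset (f := fun j => (q.1 j).2)) ?max_card //.
move=> j k; rewrite !inE => /eqP ji /eqP ki jk2.
by apply: inj_q; rewrite [LHS]surjective_pairing ji jk2 -ki -surjective_pairing.
Qed.

Lemma dotv_hashing_trmx_le q (s : 'cV[R]_l) : q \in hashing_seeds l d ->
  dotv ((hashing_mx R q)^T *m s) ((hashing_mx R q)^T *m s)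
    <= (ceil_divn d l)%:R * dotv s s.
Proof.
move=> q_seed.
have -> : dotv ((hashing_mx R q)^T *m s) ((hashing_mx R q)^T *m s)
    = \sum_j (s (q.1 j).1 0) ^+ 2.
  apply: eq_bigr => j _; rewrite hashing_trmx_mul -expr2 exprMn -exprM mulnC.
  by rewrite exprM sqrrN expr1n expr1n mul1r.
rewrite (partition_big (fun j => (q.1 j).1) xpredT) //= mulr_sumr.
apply: ler_sum => i _.
under eq_bigr => j /eqP -> do over.
rewrite sumr_const -expr2 mulr_natl.
by apply: ler_wpMn2l; rewrite ?sqr_ge0 // card_hashing_row.
Qed.

End HashingNorm.

(** * One step of the trust region method *)

Section Step.
Variables (R : realType) (l d : nat) (f : 'cV[R]_d -> R).
Variables (L theta C7 Bmax : R).
Implicit Types (x : 'cV[R]_d) (S : 'M[R]_(l, d)) (B : 'M[R]_d) (s : 'cV[R]_l).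

Lemma model_decreaseE x S B s :
  model_decrease f x S B s
    = - dotv (gradient f x) (S^T *m s)
      - 2^-1 * dotv (S^T *m s) (B *m (S^T *m s)).
Proof.
have dot0l (u : 'cV[R]_l) : dotv 0 u = 0 by rewrite dotvC dotv0.
rewrite /model_decrease /model dotv0 dot0l dotv_mulmxl.
by rewrite (dotvC s) -!mulmxA dotv_mulmxl (dotvC (B *m _)); ring.
Qed.

Lemma opnorm2_ge0 m n (A : 'M[R]_(m, n)) : 0 <= opnorm2 A.
Proof.
rewrite /opnorm2; set E := [set _ | _ in _].
have [supE|/sup_out ->//] := pselect (has_sup E).
apply: ub_le_sup; first by case: supE.
have norm20 k : norm2 (0 : 'cV[R]_k) = 0 by rewrite /norm2 dotv0 sqrtr0.
by exists 0; rewrite /= ?mulmx0 ?norm20 ?ler01.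
Qed.

(** Any t that is below the radius and satisfies t * Bmax <= norm2 (S g) is
    below the minimum in [acceptable_step]; this condition without division also
    covers Bmax = 0 and opnorm2 B = 0. *)
Lemma model_decrease_ge x alpha S B s t : 0 <= C7 ->
  acceptable_step f C7 x alpha S B s -> opnorm2 B <= Bmax ->
  0 <= t -> t <= alpha -> t * Bmax <= norm2 (S *m gradient f x) ->
  C7 * norm2 (S *m gradient f x) * t <= model_decrease f x S B s.
Proof.
move=> C7_ge0 [_ dec] leB t_ge0 le_t tB; rewrite -lee_fin EFinM.
apply: le_trans dec; apply: lee_wpmul2l.
  by rewrite lee_fin mulr_ge0 // norm2_ge0.
rewrite le_min lee_fin le_t /= /xdiv; case: eqP => [|/eqP B_neq0].
  by rewrite leey.
rewrite lee_fin ler_pdivlMr ?lt_def ?B_neq0 ?opnorm2_ge0 //.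
exact: le_trans (ler_wpM2l t_ge0 leB) tB.
Qed.

Lemma model_decrease_ge0 x alpha S B s : 0 <= C7 -> 0 <= alpha ->
  acceptable_step f C7 x alpha S B s -> opnorm2 B <= Bmax ->
  0 <= model_decrease f x S B s.
Proof.
move=> C7_ge0 alpha_ge0 acc leB.
have := model_decrease_ge C7_ge0 acc leB (lexx 0) alpha_ge0.
by rewrite mulr0 mul0r; apply; exact: norm2_ge0.
Qed.

(** Since B is positive semi-definite, the model decrease is at most its linear
    part, so it overestimates the decrease of f by at most L * K * alpha ^+ 2.
    This is absorbed by the fraction 1 - theta of the model decrease, which is
    linear in alpha. *)
Lemma small_radius_sufficient_decrease x alpha S B s (K : R) :
  0 <= L -> continuously_differentiable f -> lipschitz_gradient L f ->
  0 <= C7 -> theta <= 1 -> 0 <= alpha -> 0 <= K ->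
  acceptable_step f C7 x alpha S B s -> opnorm2 B <= Bmax -> psdmx B ->
  dotv (S^T *m s) (S^T *m s) <= K * dotv s s ->
  alpha * Bmax <= norm2 (S *m gradient f x) ->
  alpha * (L * K) <= C7 * (1 - theta) * norm2 (S *m gradient f x) ->
  sufficient_decrease f theta x S B s.
Proof.
move=> L0 df lip C70 th1 al0 K0 acc leB [_ psdB] SK aB aLK.
have md := model_decrease_ge C70 acc leB al0 (lexx alpha) aB.
have curv := psdB (S^T *m s); have desc := descent_bound x (S^T *m s) L0 df lip.
have mdE := model_decreaseE x S B s; case: acc => s_alpha _.
have ss : dotv s s <= alpha ^+ 2.
  by rewrite -sqr_norm2 ler_sqr ?nnegrE ?norm2_ge0.
have step1 : L * dotv (S^T *m s) (S^T *m s) <= L * K * alpha ^+ 2.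
  rewrite -mulrA ler_wpM2l //; apply: le_trans SK _; exact: ler_wpM2l.
have step2 : L * K * alpha ^+ 2
    <= (1 - theta) * model_decrease f x S B s.
  have h1 := ler_wpM2r al0 aLK.
  have th0 : 0 <= 1 - theta by rewrite subr_ge0.
  have h2 := ler_wpM2l th0 md; lra.
rewrite /sufficient_decrease; lra.
Qed.

End Step.

(** * Threshold radius and its exponent *)

Section Thresholds.
Variables (R : realType) (l d : nat).
Variables (L Bmax theta C7 epsS eps gamma1 gamma2 alpha0 : R).

Let sigma : R := Num.sqrt (1 - epsS) * eps.

(** The same minimum governs alpha_low, tau_alpha and h_bound: up to the factor
    sigma it is the largest radius at which a true iteration is known to
    succeed, capped at alpha0 / gamma2 ([tau_alphaE], [h_boundE]). *)
Definition radius_scale : R :=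
  fine (Order.min (Order.min (alpha_ratio l d L Bmax theta C7) (xdiv 1 Bmax))
                  (alpha0 / (sigma * gamma2))%:E).

Let mu := radius_scale.
Let K : R := (ceil_divn d l)%:R.

Hypotheses (L_ge0 : 0 <= L) (Bmax_ge0 : 0 <= Bmax).
Hypotheses (C7_gt0 : 0 < C7) (theta_lt1 : theta < 1) (alpha0_gt0 : 0 < alpha0).
Hypotheses (sigma_gt0 : 0 < sigma) (gamma2_gt0 : 0 < gamma2).

Lemma xdiv_gt0 (a b : R) : 0 < a -> 0 <= b -> (0 < xdiv a b)%E.
Proof.
rewrite /xdiv; case: eqP => [//|/eqP b0 a0 b_ge0].
by rewrite lte_fin divr_gt0 // lt_def b0.
Qed.

Lemma le_xdiv (a b t : R) : 0 <= a -> 0 <= b ->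
  (t%:E <= xdiv a b)%E -> t * b <= a.
Proof.
rewrite /xdiv; case: eqP => [-> a0 _ _|/eqP b0 a0 b_ge0].
  by rewrite mulr0.
by rewrite lee_fin ler_pdivlMr // lt_def b0.
Qed.

Let K_ge0 : 0 <= K. Proof. exact: ler0n. Qed.

Lemma radius_scaleE : mu%:E = Order.min
  (Order.min (alpha_ratio l d L Bmax theta C7) (xdiv 1 Bmax))
  (alpha0 / (sigma * gamma2))%:E.
Proof.
rewrite /mu /radius_scale fineK // ge0_fin_numE.
  by rewrite gt_min ltry orbT.
rewrite !le_min lee_fin.
rewrite !(ltW (xdiv_gt0 _ _)) ?ltr01 //= ?mulr_gt0 ?subr_gt0 //.
  exact: ltW (divr_gt0 alpha0_gt0 (mulr_gt0 sigma_gt0 gamma2_gt0)).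
by rewrite mulr_ge0 // addr_ge0 // mulr_ge0 // invr_ge0.
Qed.

Lemma radius_scale_gt0 : 0 < mu.
Proof.
rewrite -lte_fin radius_scaleE !lt_min lte_fin !xdiv_gt0 ?ltr01 //=.
- exact: divr_gt0 alpha0_gt0 (mulr_gt0 sigma_gt0 gamma2_gt0).
- by rewrite mulr_gt0 // subr_gt0.
by rewrite mulr_ge0 // addr_ge0 // mulr_ge0 // invr_ge0.
Qed.

Lemma radius_scale_Bmax : mu * Bmax <= 1.
Proof.
apply: le_xdiv => //; rewrite radius_scaleE !ge_min lexx orbT //.
Qed.

Lemma radius_scale_ratio : mu * (L * K) <= C7 * (1 - theta).
Proof.
have : mu * ((L + 2^-1 * Bmax) * K) <= C7 * (1 - theta).
  apply: le_xdiv; last by rewrite radius_scaleE !ge_min lexx.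
    by rewrite mulr_ge0 ?subr_ge0 // ltW.
  by rewrite mulr_ge0 // addr_ge0 // mulr_ge0 // invr_ge0.
apply: le_trans; rewrite ler_wpM2l ?(ltW radius_scale_gt0) // ler_wpM2r //.
by rewrite lerDl mulr_ge0 // invr_ge0.
Qed.

Lemma radius_scale_gamma2 : sigma * mu / alpha0 <= gamma2^-1.
Proof.
have : mu <= alpha0 / (sigma * gamma2).
  by rewrite -lee_fin radius_scaleE ge_min lexx orbT.
rewrite ler_pdivlMr; last exact: mulr_gt0 sigma_gt0 gamma2_gt0.
move=> le_alpha0.
by rewrite ler_pdivrMr // [leRHS]mulrC ler_pdivlMr // -mulrA mulrCA.
Qed.

Let m : R := sigma * mu / alpha0.

Lemma tau_alphaE :
  tau_alpha l d L Bmax theta C7 epsS eps gamma1 gamma2 alpha0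
    = Num.ceil (ln m / ln gamma1).
Proof.
rewrite /tau_alpha; congr (Num.ceil (ln _ / _)).
rewrite -[RHS]/(fine m%:E); congr fine.
have inv_ge0 : 0 <= alpha0^-1 by rewrite invr_ge0 ltW.
rewrite /m mulrAC mulrC EFinM radius_scaleE mine_pMl ?lee_fin;
  rewrite ?divr_ge0 ?(ltW sigma_gt0) ?ltW //.
congr (Order.min _ _).
  rewrite /alpha_low -/sigma.
  by rewrite [(sigma / _)%:E]EFinM muleA [X in (X * _)%E]muleC.
rewrite -EFinM; congr (_%:E).
by field; rewrite !lt0r_neq0.
Qed.

(** The lower bound loses a factor gamma1 because tau_alpha is rounded up; one
    of the c.+1 factors gamma1 in h_bound accounts for it. *)
Lemma tau_alpha_bounds : 0 < gamma1 < 1 -> gamma2^-1 <= 1 ->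
  exists n : nat,
    [/\ tau_alpha l d L Bmax theta C7 epsS eps gamma1 gamma2 alpha0 = n,
        alpha0 * gamma1 ^+ n <= sigma * mu
      & sigma * mu * gamma1 < alpha0 * gamma1 ^+ n].
Proof.
move=> /andP[g0 g1] gamma2_le1.
have m0 : 0 < m.
  exact: divr_gt0 (mulr_gt0 sigma_gt0 radius_scale_gt0) alpha0_gt0.
have lng : ln gamma1 < 0 by rewrite -ln1 ltr_ln ?posrE.
have m_le1 : m <= 1 := le_trans radius_scale_gamma2 gamma2_le1.
have tau_ge0 : 0 <= Num.ceil (ln m / ln gamma1).
  rewrite ceil_ge0; apply: lt_le_trans (ltrN10 _) _.
  by rewrite mulr_le0 ?ln_le0 // invr_le0 ltW.
have tauE := esym (gez0_abs tau_ge0); set n := `|_|%N in tauE.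
exists n; rewrite tau_alphaE tauE.
have /andP[] := ceil_itv (ln m / ln gamma1); rewrite tauE intrB -!pmulrn.
(* ln gamma1 < 0 reverses both inequalities. *)
rewrite ltr_ndivlMr // ler_ndivrMr // => lt_tau le_tau.
split=> //.
  rewrite mulrC -ler_pdivlMr // -ler_ln ?posrE ?exprn_gt0 // lnXn // -mulr_natl.
  by [].
rewrite [ltRHS]mulrC -ltr_pdivrMr // [ltLHS]mulrAC -/m.
have mg0 : 0 < m * gamma1 := mulr_gt0 m0 g0.
rewrite -ltr_ln ?posrE ?exprn_gt0 // lnXn // lnM ?posrE // -mulr_natl.
by move: lt_tau; rewrite mulrBl mul1r ltrBrDr.
Qed.

End Thresholds.

(** * Counting iterations through the exponent of the radius *)

Section RadiusIndex.
Variables (c p : nat) (succ : nat -> bool).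

(** Truncated subtraction is the cap at alphamax. *)
Fixpoint radius_index (k : nat) : nat :=
  if k is j.+1 then
    if succ j then (radius_index j - c)%N else (radius_index j).+1
  else p.

Lemma radius_indexP (R : realType) (gamma1 gamma2 alphamax : R)
    (alpha : nat -> R) :
  0 < gamma1 < 1 -> gamma2 = gamma1 ^- c -> 0 < alphamax ->
  alpha 0%N = alphamax * gamma1 ^+ p ->
  (forall k, alpha k.+1 = if succ k then Num.min alphamax (gamma2 * alpha k)
                          else gamma1 * alpha k) ->
  forall k, alpha k = alphamax * gamma1 ^+ radius_index k.
Proof.
move=> /andP[g0 g1] -> am0 alpha_0 alphaS; elim=> [//|k IHk].
rewrite alphaS /=; case: ifP => _; rewrite IHk; last by rewrite exprS mulrCA.
set i := radius_index k; rewrite mulrCA.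
have [le_ci|lt_ic] := leqP c i.
  have -> : gamma1 ^- c * gamma1 ^+ i = gamma1 ^+ (i - c).
    rewrite -{1}(subnK le_ci) exprD mulrCA mulVf ?mulr1 //.
    by rewrite expf_neq0 ?lt0r_neq0.
  by apply/min_idPr; rewrite ler_piMr ?(ltW am0) // exprn_ile1 // ltW.
have /eqP -> : (i - c == 0)%N by rewrite subn_eq0 ltnW.
rewrite expr0 mulr1; apply/min_idPl.
rewrite ler_peMr ?(ltW am0) // mulrC ler_pdivlMr ?exprn_gt0 // mul1r.
exact: ler_wiXn2l (ltW g0) (ltW g1) _ _ (ltnW lt_ic).
Qed.

(** The distance of the exponent to the threshold a is a potential.  A good
    failure happens below a and a good success above a + c, so both decrease it
    by at least 1, which pays for the iteration.  Any other iteration increases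
    it by at most c, and is charged c + 1. *)
Lemma leq_iterations (good : nat -> bool) (a N : nat) : (0 < c)%N ->
  (forall k, (k < N)%N -> good k -> (a <= radius_index k)%N -> succ k) ->
  (N <= c.+1 * (\sum_(k < N) ~~ good k
       + \sum_(k < N) [&& good k, succ k & (radius_index k <= a + c)%N])
     + ((p - a) + (a - p)))%N.
Proof.
move=> c_gt0 good_succ.
pose gap k := (radius_index k - a + (a - radius_index k))%N.
apply: leq_trans (leq_addr (gap N) N) _.
elim: N good_succ => [|N IHN] good_succ.
  by rewrite !big_ord0 muln0 !add0n.
have {}IHN := IHN (fun k lt_kN => good_succ k (leqW lt_kN)).
have := good_succ N (ltnSn N); rewrite !big_ord_recr /= /gap /=.
move: IHN; rewrite /gap /=.
case: (good N); case: (succ N); move: (radius_index N) => i /= IHN no_fail.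
- by case: (leqP i (a + c)) => le_i; nia.
- by case: (leqP a i) => [/(no_fail isT)//|lt_i]; nia.
- by nia.
- by nia.
Qed.

End RadiusIndex.

(** * Lower-tail Chernoff bound for dependent trials *)

Section LowerTail.
Variables (R : realType) (disp : measure_display) (Omega : measurableType disp).
Variable P : probability Omega R.

Local Notation pr A := (fine (P A)).

Lemma prE A : measurable A -> P A = (pr A)%:E.
Proof. by move=> mA; rewrite fineK // fin_num_measure. Qed.

Lemma pr_split (A B : set Omega) : measurable A -> measurable B ->
  pr A = pr (A `&` B) + pr (A `\` B).
Proof.
move=> mA mB; apply: EFin_inj.
have mAB : measurable (A `&` B) by exact: measurableI.
have mADB : measurable (A `\` B) by exact: measurableD.
by rewrite EFinD -!prE // addeC; exact: measureDI.
Qed.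

Lemma expRN_le_quadratic (x : R) : 0 <= x -> expR (- x) <= 1 - x + x ^+ 2 / 2.
Proof.
move=> x_ge0.
(* g' t = expR (- t) - (1 - t) >= 0 and g 0 = 0. *)
pose g (t : R) := 1 - t + t ^+ 2 / 2 - expR (- t).
have dg (t : R) : is_derive t (1 : R) g (expR (- t) - (1 - t)).
  rewrite /g; apply: is_derive_eq.
  by rewrite /GRing.scale /=; field.
have cg : {within `[0, x], continuous g}.
  apply: continuous_subspaceT => t; apply: differentiable_continuous.
  by apply/derivable1_diffP; case: (dg t).
have [t _] := MVT_segment x_ge0 (fun t _ => dg t) cg.
rewrite subr0 {2}/g subr0 expr0n mul0r addr0 oppr0 expR0 subrr subr0 => gx.
rewrite -subr_ge0 -/(g x) gx mulr_ge0 // subr_ge0.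
exact: expR_ge1Dx.
Qed.

Variables (T : nat -> set Omega) (F : nat -> set (set Omega)) (q : R).
Hypothesis F_measurable : forall k, F k `<=` measurable.
Hypothesis F_mono : forall k, F k `<=` F k.+1.
Hypothesis F_setI : forall k A B, F k A -> F k B -> F k (A `&` B).
Hypothesis F_setD : forall k A B, F k A -> F k B -> F k (A `\` B).
Hypothesis F_T : forall k, F k.+1 (T k).
Hypothesis T_likely : forall k H, F k H -> q * pr H <= pr (T k `&` H).

Definition few_hits k n (t : R) : set Omega :=
  [set w | (\sum_(j < n) `[< T (k + j) w >])%:R <= t].

(** Conditioning on the first trial, so that the induction on the number of
    trials can enlarge the past. *)
Lemma few_hitsS k n t :
  few_hits k n.+1 t
    = (T k `&` few_hits k.+1 n (t - 1)) `|` (few_hits k.+1 n t `\` T k).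
Proof.
have shift w : (\sum_(j < n) `[< T (k + lift ord0 j) w >]
    = \sum_(j < n) `[< T (k.+1 + j) w >])%N.
  by apply: eq_bigr => j _; rewrite addnS.
apply/seteqP; split=> w; rewrite /few_hits /= big_ord_recl addn0 shift.
  case: asboolP => Tw; rewrite ?add0n; last by move=> ?; right.
  by rewrite natrD /= => le_t; left; split=> //; rewrite /few_hits /=; lra.
case=> [[/asboolP -> /=]|[le_t /asboolPn/negbTE -> //]].
by rewrite natrD => le_t; lra.
Qed.

Lemma measurable_few_hits k n t : measurable (few_hits k n t).
Proof.
have mT j : measurable (T j) := F_measurable (F_T j).
elim: n k t => [|n IHn] k t.
  rewrite /few_hits; under eq_set do rewrite big_ord0.
  have [t0|t0] := pselect (0%:R <= t).
    by rewrite (_ : [set _ | _] = setT) //; apply/seteqP; split.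
  by rewrite (_ : [set _ | _] = set0) //; apply/seteqP; split.
rewrite few_hitsS; apply: measurableU; first exact: measurableI.
exact: measurableD.
Qed.

(** Exponential Markov inequality without expectations.  Restricting to an event
    H of the past takes the place of conditional expectations: one trial
    replaces H by H `&` T k, where the weight shrinks by expR (- lam), and
    H `\` T k, and T_likely says that the first part has at least the share q
    of the mass of H. *)
Lemma lower_tail_exponential lam n k t H : 0 <= q <= 1 -> 0 <= lam ->
  F k H -> pr (few_hits k n t `&` H)
    <= expR (lam * t) * (1 - q * (1 - expR (- lam))) ^+ n * pr H.
Proof.
move=> /andP[q_ge0 q_le1] lam_ge0; set r := 1 - _.
have x_le1 : expR (- lam) <= 1 by rewrite -expR0 ler_expR oppr_le0.
have x_gt0 := expR_gt0 (- lam).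
have r_ge0 : 0 <= r by rewrite /r; nra.
elim: n k t H => [|n IHn] k t H FH; have mH := F_measurable FH.
  rewrite expr0 mulr1 /few_hits; under eq_set do rewrite big_ord0.
  have [t_ge0|t_lt0] := leP 0 t.
    rewrite (_ : [set _ | _] `&` H = H); last by apply/seteqP; split=> w // [].
    by rewrite ler_peMl ?fine_ge0 // -expR0 ler_expR mulr_ge0.
  rewrite (_ : [set _ | _] `&` H = set0).
    by rewrite measure0 mulr_ge0 ?fine_ge0 ?expR_ge0.
  by apply/seteqP; split=> w // [].
have mT : measurable (T k) := F_measurable (F_T k).
have mF := measurable_few_hits.
have FHT : F k.+1 (H `&` T k) by apply: F_setI => //; exact: F_mono.
have FHD : F k.+1 (H `\` T k) by apply: F_setD => //; exact: F_mono.
have split_T : pr (few_hits k n.+1 t `&` H)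
     = pr (few_hits k.+1 n (t - 1) `&` (H `&` T k))
       + pr (few_hits k.+1 n t `&` (H `\` T k)).
  rewrite (@pr_split _ (T k)) //; last exact: measurableI.
  congr (pr _ + pr _); rewrite few_hitsS; apply/seteqP; split=> w /=.
  - by case=> [[[[] ?|[]]]].
  - by case=> ? [? ?]; split=> //; split=> //; left.
  - by case=> [[[[] ?|[]]]].
  - by case=> ? [? ?]; split=> //; split=> //; right.
rewrite split_T.
apply: le_trans (lerD (IHn _ _ _ FHT) (IHn _ _ _ FHD)) _.
have -> : expR (lam * (t - 1)) = expR (lam * t) * expR (- lam).
  by rewrite -expRD mulrBr mulr1.
rewrite exprS.
have := T_likely FH; rewrite setIC (@pr_split H (T k)) //.
set u := pr (_ `&` _); set v := pr (_ `\` _); move=> le_u.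
have y_ge0 : 0 <= expR (lam * t) * r ^+ n.
  by rewrite mulr_ge0 ?expR_ge0 ?exprn_ge0.
suff : expR (- lam) * u + v <= r * (u + v).
  by move=> h; have := ler_wpM2l y_ge0 h; lra.
rewrite /r; nra.
Qed.

(** The choice lam = delta is not optimal, but the quadratic bound on
    expR (- delta) makes it give the usual exponent delta ^+ 2 / 2. *)
Lemma chernoff_lower_tail n delta : 0 <= q <= 1 -> 0 <= delta -> F 0 setT ->
  pr (few_hits 0 n ((1 - delta) * q * n%:R))
    <= expR (- (delta ^+ 2 / 2 * q * n%:R)).
Proof.
move=> q01 delta_ge0 FT; have /andP[q_ge0 q_le1] := q01.
rewrite -[few_hits _ _ _]setIT.
apply: le_trans (lower_tail_exponential n _ q01 delta_ge0 FT) _.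
rewrite probability_setT mulr1.
have quad := expRN_le_quadratic delta_ge0.
have := expR_ge1Dx (- (q * (1 - expR (- delta)))).
set y := q * _ => le_exp; rewrite -mulrA.
have y_le1 : 0 <= 1 - y by rewrite /y; have := expR_gt0 (- delta); nra.
have pow_le : (1 - y) ^+ n <= expR (- y * n%:R).
  by rewrite expRM_natr lerXn2r ?nnegrE ?expR_ge0.
apply: le_trans (ler_wpM2l (expR_ge0 _) pow_le) _.
rewrite -expRD ler_expR.
have n_ge0 : 0 <= n%:R :> R by [].
have : q * (delta - delta ^+ 2 / 2) <= y by rewrite ler_wpM2l //; lra.
move=> /(ler_wpM2r n_ge0); lra.
Qed.

End LowerTail.

(** * Probability of a true iteration given the past *)

Section Borel.

Lemma borel_closed (T : ptopologicalType) (C : set T) :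
  closed C -> <<s @open T >> C.
Proof.
move=> closedC; rewrite -[C]setCK; apply: sigma_algebraC.
by apply: sub_sigma_algebra; exact: closed_openC.
Qed.

Lemma borel_finite_mx (R : realType) m n (A : set 'M[R]_(m, n)) :
  finite_set A -> <<s @open 'M[R]_(m, n) >> A.
Proof.
move=> finA; apply: borel_closed; apply: accessible_finite_set_closed.1 => //.
exact/hausdorff_accessible/norm_hausdorff.
Qed.

End Borel.

Section GoodSketch.
Variables (R : realType) (l d : nat) (epsS : R).

Definition preserves_norm (y : 'cV[R]_d) : set 'M[R]_(l, d) :=
  [set M | (1 - epsS) * norm2 y ^+ 2 <= norm2 (M *m y) ^+ 2].

(** Requiring a hashing matrix makes the bound on the norm of its transpose
    hold on every good sketch, instead of almost surely. *)
Definition good_sketch (y : 'cV[R]_d) : set 'M[R]_(l, d) :=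
  [set hashing_mx R q | q in [set` hashing_seeds l d]] `&` preserves_norm y.

Lemma continuous_dotv n (T : topologicalType) (u v : T -> 'cV[R]_n) :
  (forall i, continuous (fun t => u t i 0)) ->
  (forall i, continuous (fun t => v t i 0)) ->
  continuous (fun t => dotv (u t) (v t)).
Proof.
move=> cu cv; apply: (continuous_big add_continuous) => i _ t.
by apply: cvgM; [exact: cu|exact: cv].
Qed.

Lemma continuous_gradient_coord (f : 'cV[R]_d -> R) i :
  continuous (gradient f) -> continuous (fun x => gradient f x i 0).
Proof.
move=> cg x; apply: (@continuous_comp _ _ _ (gradient f) (fun g => g i 0)).
  exact: cg.
exact: coord_continuous.
Qed.

Lemma closed_preserves_norm (f : 'cV[R]_d -> R) (M : 'M[R]_(l, d)) :
  continuous (gradient f) -> closed [set x | preserves_norm (gradient f x) M].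
Proof.
move=> cg.
have cgi i := @continuous_gradient_coord f i cg.
have cMgi i : continuous (fun x => (M *m gradient f x) i 0).
  under eq_fun do rewrite mxE.
  apply: (continuous_big add_continuous) => j _ x.
  exact: cvgM (cvg_cst (M i j)) (cgi j x).
pose gap x := dotv (M *m gradient f x) (M *m gradient f x)
  - (1 - epsS) * dotv (gradient f x) (gradient f x).
rewrite (_ : [set _ | _] = gap @^-1` [set r | 0 <= r]); last first.
  apply/seteqP; split=> x; rewrite /preserves_norm /=;
    by rewrite !sqr_norm2 /gap subr_ge0.
apply: preimage_closed; last exact: closed_ge.
have cgg := continuous_dotv cgi cgi; have cMgg := continuous_dotv cMgi cMgi.
move=> x _; exact: cvgB (cMgg x) (cvgM (cvg_cst (1 - epsS)) (cgg x)).
Qed.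

Lemma stable_hashing_le (A A' : set 'M[R]_(l, d)) :
  (forall q, q \in hashing_seeds l d -> A (hashing_mx R q) ->
    A' (hashing_mx R q)) ->
  stable_hashing A <= stable_hashing A'.
Proof.
move=> sAA'; rewrite /stable_hashing ler_wpM2r ?invr_ge0 // ler_nat.
apply/subset_leq_card/fintype.subsetP => q; rewrite !inE.
move=> /andP[q_seed /asboolP Aq].
by rewrite q_seed; apply/asboolP; apply: sAA' Aq; rewrite inE.
Qed.

End GoodSketch.

(** Law of total probability over the finitely many values of Z. *)
Lemma partition_likely (R : realType) disp (Omega : measurableType disp)
    (P : probability Omega R) (I : finType) (Z : Omega -> I)
    (A H : set Omega) (q : R) :
  0 <= q -> measurable A -> measurable H ->
  (forall i, measurable (Z @^-1` [set i])) ->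
  (forall i, (q%:E * P (H `&` Z @^-1` [set i])
              <= P (A `&` (H `&` Z @^-1` [set i])))%E) ->
  (q%:E * P H <= P (A `&` H))%E.
Proof.
move=> q_ge0 mA mH mZ le_i.
have finI : finite_set [set: I] by exact: finite_finset.
have split_Z (E : set Omega) : measurable E ->
    P E = (\sum_(i \in [set: I]) P (E `&` Z @^-1` [set i]))%E.
  move=> mE; rewrite -measure_fin_bigcup //.
  - rewrite -setI_bigcupr (_ : \bigcup_(_ in _) _ = setT) ?setIT //.
    by apply/seteqP; split=> w // _; exists (Z w).
  - by move=> i j _ _ [w [[_ <-] [_ <-]]].
  - by move=> i _; exact: measurableI.
rewrite (split_Z H) // (split_Z (A `&` H)); last exact: measurableI.
rewrite !fsbig_finite // ge0_sume_distrr; last by move=> i _.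
by apply: lee_sum => i _; rewrite -setIA.
Qed.

Section SketchProbability.
Variables (R : realType) (l d : nat) (f : 'cV[R]_d -> R) (epsS : R).
Variables (gamma1 gamma2 theta alphamax C7 : R).
Variables (disp : measure_display) (Omega : measurableType disp).
Variable P : probability Omega R.
Variables (x : nat -> Omega -> 'cV[R]_d) (alpha : nat -> Omega -> R).
Variables (S : nat -> Omega -> 'M[R]_(l, d)) (B : nat -> Omega -> 'M[R]_d).
Variable shat : nat -> Omega -> 'cV[R]_l.
Variables (x0 : 'cV[R]_d) (alpha0 : R).

Hypothesis cont_grad : continuous (gradient f).
Hypothesis run : trust_region_run f gamma1 gamma2 theta alphamax C7 P x alpha S
  B shat x0 alpha0.

Local Notation past := (history x alpha S B shat).

Definition true_iteration (k : nat) : set Omega :=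
  [set w | good_sketch epsS (gradient f (x k w)) (S k w)].

Lemma random_elementP (T : ptopologicalType) (X : Omega -> T) U :
  random_element X -> open U -> measurable (X @^-1` U).
Proof.
move=> rX openU; rewrite -[_ @^-1` _]setTI; apply: rX => //.
exact: sub_sigma_algebra.
Qed.

Lemma past_measurable k H : past k H -> measurable H.
Proof.
move: H; rewrite -[forall H, _]/(past k `<=` measurable).
apply: smallest_sub; first exact: sigma_algebra_measurable.
move=> A [[j _]|[j _]].
  have [_ _ rS rB rs] := run_random run j.
  by case=> [[|]|] [U openU <-]; exact: random_elementP.
have [rx ra _ _ _] := run_random run j.
by case=> [] [U openU <-]; exact: random_elementP.
Qed.

Lemma past_mono k : past k `<=` past k.+1.
Proof.
apply: sub_sigma_algebra2 => A [[j lt_jk Aj]|[j le_jk Aj]]; [left|right].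
  by exists j => //=; exact: ltnW.
by exists j => //=; exact: leqW.
Qed.

(** The past as a measurable type, to reuse the closure properties of measurable
    sets. *)
Let past_type k : measurableType _ := g_sigma_algebraType
  (\bigcup_(j in [set j | (j < k)%N]) (open_preimages (S j)
     `|` open_preimages (B j) `|` open_preimages (shat j))
   `|` \bigcup_(j in [set j | (j <= k)%N]) (open_preimages (x j)
     `|` open_preimages (alpha j))).

Lemma past_setI k H H' : past k H -> past k H' -> past k (H `&` H').
Proof. exact: (@measurableI _ (past_type k)). Qed.

Lemma past_setD k H H' : past k H -> past k H' -> past k (H `\` H').
Proof. exact: (@measurableD _ (past_type k)). Qed.

Lemma past_setT k : past k setT.
Proof. exact: (@measurableT _ (past_type k)). Qed.

Lemma past_iterate k j C : (j <= k)%N -> closed C -> past k (x j @^-1` C).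
Proof.
move=> le_jk closedC; rewrite -[C]setCK preimage_setC; apply: sigma_algebraC.
apply: sub_sigma_algebra; right; exists j => //; left.
by exists (~` C) => //; exact: closed_openC.
Qed.

Lemma past_sketch k M : past k.+1 (S k @^-1` [set M]).
Proof.
rewrite -[[set M]]setCK preimage_setC; apply: sigma_algebraC.
apply: sub_sigma_algebra; left; exists k => /=; first exact: ltnSn.
left; left; exists (~` [set M]) => //; apply: closed_openC.
by apply: accessible_closed_set1; exact/hausdorff_accessible/norm_hausdorff.
Qed.

Lemma past_preserves_norm k (M : 'M[R]_(l, d)) :
  past k [set w | preserves_norm epsS (gradient f (x k w)) M].
Proof.
exact: (past_iterate (leqnn k) (closed_preserves_norm cont_grad)).
Qed.

Lemma past_true_iteration k : past k.+1 (true_iteration k).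
Proof.
rewrite (_ : true_iteration k = \bigcup_(q in [set` hashing_seeds l d])
  ((S k @^-1` [set hashing_mx R q]) `&`
   [set w | preserves_norm epsS (gradient f (x k w)) (hashing_mx R q)])).
  apply: (@fin_bigcup_measurable _ (past_type k.+1)).
    exact: finite_finset.
  move=> q _; apply: past_setI; first exact: past_sketch.
  apply: past_mono; exact: past_preserves_norm.
apply/seteqP; split=> w.
  by case=> [[q q_seed Sq] norm_ok]; exists q; rewrite //= Sq.
by case=> q q_seed [/= Sq norm_ok]; split; rewrite ?Sq //; exists q.
Qed.

(** The set of seeds that preserve the norm of the current gradient takes
    finitely many values and is determined by the past: on each of its level
    sets, being true becomes an event about the sketch alone, to which
    independence applies. *)
Let good_seeds k w : {set hashing_seed l d} :=
  [set q in hashing_seeds l d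
    | `[< preserves_norm epsS (gradient f (x k w)) (hashing_mx R q) >]].

Lemma past_good_seeds k Q : past k (good_seeds k @^-1` [set Q]).
Proof.
rewrite (_ : _ @^-1` _ = \bigcap_(q in setT)
    [set w | (q \in good_seeds k w) = (q \in Q)]); last first.
  apply/seteqP; split=> w /=; first by move=> <-.
  by move=> eqQ; apply/setP => q; exact: eqQ.
apply: (@fin_bigcap_measurable _ (past_type k)); first exact: finite_finset.
move=> q _.
have past_q : past k [set w | q \in good_seeds k w].
  have [q_seed|q_notseed] := boolP (q \in hashing_seeds l d).
    rewrite (_ : [set _ | _] =
      [set w | preserves_norm epsS (gradient f (x k w)) (hashing_mx R q)]).
      exact: past_preserves_norm.
    apply/seteqP; split=> w; rewrite /= inE q_seed /=; last by move/asboolP.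
    by move/asboolP.
  rewrite (_ : [set _ | _] = set0); first exact: (@measurable0 _ (past_type k)).
  by apply/seteqP; split=> w //; rewrite /= inE (negbTE q_notseed).
have [qQ|q_notQ] := boolP (q \in Q).
  rewrite (_ : [set _ | _] = [set w | q \in good_seeds k w]).
    exact: past_q.
  by apply/seteqP; split=> w /= ->.
rewrite (_ : [set _ | _] = ~` [set w | q \in good_seeds k w]).
  exact: sigma_algebraC.
by apply/seteqP; split=> w /= => [->//|/negP/negbTE].
Qed.

Lemma true_iteration_likely delta k H : delta <= 1 -> past k H ->
  (forall y, range (gradient f) y ->
    1 - delta <= stable_hashing (@preserves_norm R l d epsS y)) ->
  ((1 - delta)%:E * P H <= P (true_iteration k `&` H))%E.
Proof.
move=> delta_le1 past_H likely.
apply: (@partition_likely _ _ _ _ _ (good_seeds k)); rewrite ?subr_ge0 //.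
- exact (past_measurable (@past_true_iteration k)).
- exact (past_measurable past_H).
- by move=> Q; exact (past_measurable (@past_good_seeds k Q)).
move=> Q; set E := H `&` _.
have past_E : past k E by apply: past_setI => //; exact: past_good_seeds.
have [->|/set0P[w0 [Hw0 Qw0]]] := eqVneq E set0.
  by rewrite setI0 measure0 mule0.
pose A := [set hashing_mx R q | q in [set` Q]].
have borelA : <<s @open 'M[R]_(l, d) >> A.
  by apply: borel_finite_mx; apply: finite_image; exact: finite_finset.
have -> : true_iteration k `&` E = S k @^-1` A `&` E.
  apply/seteqP; split=> w [Tw [Hw Qw]]; split=> //.
    case: Tw => [[q q_seed Sq] norm_ok]; exists q => //=.
    by rewrite -Qw inE; move: q_seed => /= ->; apply/asboolP; rewrite Sq.
  case: Tw => q /=; rewrite -Qw inE => /andP[q_seed /asboolP norm_ok] Sq.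
  by split; [exists q|rewrite -Sq].
rewrite (run_indep run) // (run_law run) //; apply: lee_wpmul2r => //.
rewrite lee_fin; apply: le_trans (likely (gradient f (x k w0)) _) _.
  by exists (x k w0).
apply: stable_hashing_le => q q_seed norm_ok; exists q => //=.
by rewrite -Qw0 inE q_seed; exact/asboolP.
Qed.

End SketchProbability.

(** * Pathwise bound on the number of true iterations *)

Lemma count_decrease_le (R : realDomainType) (u : nat -> R) (b : pred nat) h N :
  (forall k, u k.+1 <= u k) ->
  (forall k, (k < N)%N -> b k -> h <= u k - u k.+1) ->
  (\sum_(k < N) b k)%:R * h <= u 0%N - u N.
Proof.
move=> u_dec; elim: N => [|N IHN] dec; first by rewrite big_ord0 mul0r subrr.
rewrite big_ord_recr /= natrD mulrDl.
have {}IHN := IHN (fun k lt_kN => dec k (leqW lt_kN)).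
have := dec N (ltnSn N); case: (b N) => [/(_ isT)|_] /=; first lra.
by have := u_dec N; lra.
Qed.

Section Path.
Variables (R : realType) (l d : nat) (f : 'cV[R]_d -> R).
Variables (L fstar epsS : R) (c p : nat).
Variables (gamma1 gamma2 theta alphamax alpha0 C7 Bmax eps : R).
Variables (x : nat -> 'cV[R]_d) (alpha : nat -> R) (S : nat -> 'M[R]_(l, d)).
Variables (B : nat -> 'M[R]_d) (shat : nat -> 'cV[R]_l) (N : nat).

Hypotheses (df : continuously_differentiable f) (L_ge0 : 0 <= L).
Hypotheses (lip : lipschitz_gradient L f) (f_ge : forall y, fstar <= f y).
Hypotheses (epsS01 : 0 < epsS < 3 / 4) (gamma1_01 : 0 < gamma1 < 1).
Hypotheses (c_gt0 : (0 < c)%N) (gamma2E : gamma2 = gamma1 ^- c).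
Hypotheses (theta01 : 0 < theta < 1) (alphamax_gt0 : 0 < alphamax).
Hypotheses (alpha0E : alpha0 = alphamax * gamma1 ^+ p) (C7_gt0 : 0 < C7).
Hypotheses (Bmax_ge0 : 0 <= Bmax) (eps_gt0 : 0 < eps).

Let succ k := sufficient_decrease f theta (x k) (S k) (B k) (shat k).
Let good k := good_sketch epsS (gradient f (x k)) (S k).

Hypothesis alpha_0 : alpha 0%N = alpha0.
Hypothesis B_psd : forall k, psdmx (B k).
Hypothesis B_le : forall k, opnorm2 (B k) <= Bmax.
Hypothesis step :
  forall k, acceptable_step f C7 (x k) (alpha k) (S k) (B k) (shat k).
Hypothesis update : forall k,
  if succ k
  then x k.+1 = x k + (S k)^T *m shat k /\
       alpha k.+1 = Num.min alphamax (gamma2 * alpha k)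
  else x k.+1 = x k /\ alpha k.+1 = gamma1 * alpha k.
Hypothesis grad_gt : forall k, (k < N)%N -> eps < norm2 (gradient f (x k)).

Let sigma : R := Num.sqrt (1 - epsS) * eps.
Let mu : R :=
  radius_scale l d L Bmax theta C7 epsS eps gamma2 alpha0.
Let h := h_bound l d c L Bmax theta C7 epsS eps gamma1 gamma2 alpha0.
Let tau := tau_alpha l d L Bmax theta C7 epsS eps gamma1 gamma2 alpha0.
Let idx := radius_index c p succ.

Let gamma1_gt0 : 0 < gamma1. Proof. by case/andP: gamma1_01. Qed.
Let gamma1_le1 : gamma1 <= 1. Proof. by case/andP: gamma1_01 => _ /ltW. Qed.
Let theta_gt0 : 0 < theta. Proof. by case/andP: theta01. Qed.
Let theta_lt1 : theta < 1. Proof. by case/andP: theta01. Qed.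
Let epsS_lt1 : 0 < 1 - epsS. Proof. by case/andP: epsS01; lra. Qed.
Let sigma_gt0 : 0 < sigma. Proof. by rewrite mulr_gt0 ?sqrtr_gt0. Qed.
Let gamma2_gt0 : 0 < gamma2. Proof. by rewrite gamma2E invr_gt0 exprn_gt0. Qed.
Let alpha0_gt0 : 0 < alpha0. Proof. by rewrite alpha0E mulr_gt0 ?exprn_gt0. Qed.

Let mu_gt0 : 0 < mu.
Proof.
exact: (radius_scale_gt0 l d L_ge0 Bmax_ge0 C7_gt0 theta_lt1 alpha0_gt0
  sigma_gt0 gamma2_gt0).
Qed.

Let mu_Bmax : mu * Bmax <= 1.
Proof.
exact: (radius_scale_Bmax l d L_ge0 Bmax_ge0 C7_gt0 theta_lt1 alpha0_gt0
  sigma_gt0 gamma2_gt0).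
Qed.

Let mu_ratio : mu * (L * (ceil_divn d l)%:R) <= C7 * (1 - theta).
Proof.
exact: (radius_scale_ratio l d L_ge0 Bmax_ge0 C7_gt0 theta_lt1 alpha0_gt0
  sigma_gt0 gamma2_gt0).
Qed.

Lemma path_radiusE k : alpha k = alphamax * gamma1 ^+ idx k.
Proof.
apply: (radius_indexP gamma1_01 gamma2E alphamax_gt0) k.
  by rewrite alpha_0.
by move=> k; have := update k; case: (succ k) => -[].
Qed.

Let alpha_gt0 k : 0 < alpha k.
Proof. by rewrite path_radiusE mulr_gt0 ?exprn_gt0. Qed.

Lemma path_nonincreasing k : f (x k.+1) <= f (x k).
Proof.
have := update k; case: ifP => [suc [-> _]|_ [-> _]] //.
have md :=
  model_decrease_ge0 (ltW C7_gt0) (ltW (alpha_gt0 k)) (step k) (B_le k).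
have := mulr_ge0 (ltW theta_gt0) md.
by move: suc; rewrite /succ /sufficient_decrease; lra.
Qed.

Lemma good_sketch_ge k : (k < N)%N -> good k ->
  sigma <= norm2 (S k *m gradient f (x k)).
Proof.
move=> lt_kN [_ /=]; rewrite /preserves_norm /= => le_S.
rewrite -ler_sqr ?nnegrE ?norm2_ge0 ?(ltW sigma_gt0) //.
apply: le_trans le_S; rewrite exprMn sqr_sqrtr ?(ltW epsS_lt1) //.
rewrite ler_wpM2l ?(ltW epsS_lt1) // ler_sqr ?nnegrE ?norm2_ge0 ?ltW //.
exact: grad_gt.
Qed.

Lemma good_small_radius_success k : (k < N)%N -> good k ->
  alpha k <= sigma * mu -> succ k.
Proof.
move=> lt_kN gk le_alpha; have le_v := good_sketch_ge lt_kN gk.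
case: (gk) => -[q /= q_seed Sq] _.
have SK := dotv_hashing_trmx_le (shat k) q_seed; rewrite Sq in SK.
apply: (small_radius_sufficient_decrease (alpha := alpha k) L_ge0 df lip
  (ltW C7_gt0) (ltW theta_lt1) _ _ (step k) (B_le k) (B_psd k) SK) => //;
  first exact: ltW.
  apply: le_trans le_v; apply: le_trans (ler_wpM2r Bmax_ge0 le_alpha) _.
  by rewrite -mulrA ler_piMr ?(ltW sigma_gt0).
have C70 : 0 <= C7 * (1 - theta) by rewrite mulr_ge0 ?subr_ge0 ?ltW.
apply: le_trans (ler_wpM2l C70 le_v).
have LK0 : 0 <= L * (ceil_divn d l)%:R by rewrite mulr_ge0.
apply: le_trans (ler_wpM2r LK0 le_alpha) _.
by rewrite [leRHS]mulrC -mulrA ler_wpM2l ?(ltW sigma_gt0).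
Qed.

Lemma h_boundE : h = theta * (C7 * sigma * (gamma1 ^+ c.+1 * (sigma * mu))).
Proof.
rewrite /h /h_bound.
rewrite -/(radius_scale l d L Bmax theta C7 epsS eps gamma2 alpha0) -/mu.
have -> : (1 - epsS) = Num.sqrt (1 - epsS) ^+ 2 by rewrite sqr_sqrtr // ltW.
by rewrite /sigma; ring.
Qed.

Let scale_gt0 : 0 < gamma1 ^+ c.+1 * (sigma * mu).
Proof.
exact: mulr_gt0 (exprn_gt0 _ gamma1_gt0) (mulr_gt0 sigma_gt0 mu_gt0).
Qed.

Lemma h_bound_gt0 : 0 < h.
Proof.
rewrite h_boundE; apply: (mulr_gt0 theta_gt0).
exact: mulr_gt0 (mulr_gt0 C7_gt0 sigma_gt0) scale_gt0.
Qed.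

(** The model decrease is evaluated at t = gamma1 ^+ c.+1 * (sigma * mu), which
    is below the radius by hypothesis and below norm2 (S g) / Bmax because
    gamma1 <= 1. *)
Lemma good_success_decrease k : (k < N)%N -> good k -> succ k ->
  gamma1 ^+ c.+1 * (sigma * mu) <= alpha k -> h <= f (x k) - f (x k.+1).
Proof.
move=> lt_kN gk suc le_t; have le_v := good_sketch_ge lt_kN gk.
have := update k; rewrite suc => -[-> _]; apply: le_trans suc.
rewrite h_boundE ler_wpM2l ?(ltW theta_gt0) //.
set t := gamma1 ^+ c.+1 * _ in le_t *.
have t_ge0 : 0 <= t := ltW scale_gt0.
have tB : t * Bmax <= norm2 (S k *m gradient f (x k)).
  apply: le_trans le_v; rewrite /t.
  rewrite -(mulrA _ (sigma * mu)) -(mulrA sigma) mulrCA.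
  rewrite ler_piMr ?(ltW sigma_gt0) //.
  apply: mulr_ile1 => //; first exact: exprn_ge0 (ltW gamma1_gt0).
    exact: mulr_ge0 (ltW mu_gt0) Bmax_ge0.
  exact: exprn_ile1 (ltW gamma1_gt0) gamma1_le1.
apply: le_trans
  (model_decrease_ge (ltW C7_gt0) (step k) (B_le k) t_ge0 le_t tB).
by rewrite ler_wpM2r // ler_wpM2l // ltW.
Qed.

Lemma sum_good_success_le (a : nat) :
  (forall k, (idx k <= a)%N -> gamma1 ^+ c.+1 * (sigma * mu) <= alpha k) ->
  (\sum_(k < N) [&& `[< good k >], succ k & (idx k <= a)%N])%:R * h
    <= f (x 0%N) - fstar.
Proof.
move=> large; apply: (le_trans (y := f (x 0%N) - f (x N))); last first.
  by rewrite lerD2l lerN2.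
apply: (@count_decrease_le R (f \o x)
  (fun k => [&& `[< good k >], succ k & (idx k <= a)%N])).
  exact: path_nonincreasing.
move=> k lt_kN /and3P[/asboolP gk sk le_a].
exact: good_success_decrease lt_kN gk sk (large k le_a).
Qed.

(** The threshold exponent is p + tau: at larger exponents true iterations
    succeed, and the exponents up to p + tau + c are those at which a true
    success is guaranteed to decrease f by h. *)
Lemma true_iterations_le :
  (\sum_(k < N) `[< good k >])%:R <= N%:R * (1 - c.+1%:R^-1)
    + ((f (x 0%N) - fstar) / h + tau%:~R / (1 + c%:R)).
Proof.
have inv_gamma2 : gamma2^-1 <= 1.
  by rewrite gamma2E invrK exprn_ile1 // ltW.
have [t [tauE tau_le tau_gt]] := tau_alpha_bounds l d L_ge0 Bmax_ge0 C7_gt0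
  theta_lt1 alpha0_gt0 sigma_gt0 gamma2_gt0 gamma1_01 inv_gamma2.
rewrite -/tau -/mu in tauE tau_le tau_gt.
have small k : (p + t <= idx k)%N -> alpha k <= sigma * mu.
  move=> le_idx; apply: le_trans tau_le.
  rewrite path_radiusE alpha0E -mulrA -exprD.
  by rewrite ler_wpM2l ?(ltW alphamax_gt0) // ler_wiXn2l // ltW.
have large k : (idx k <= p + t + c)%N ->
    gamma1 ^+ c.+1 * (sigma * mu) <= alpha k.
  move=> le_idx; rewrite exprS [gamma1 * _]mulrC -mulrA [gamma1 * _]mulrC.
  have gc_ge0 : 0 <= gamma1 ^+ c by rewrite exprn_ge0 // ltW.
  apply: le_trans (ler_wpM2l gc_ge0 (ltW tau_gt)) _.
  rewrite path_radiusE alpha0E mulrC -!mulrA -!exprD addnA.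
  by rewrite ler_wpM2l ?(ltW alphamax_gt0) // ler_wiXn2l // ltW.
have count := @leq_iterations c p succ (fun k => `[< good k >]) (p + t) N c_gt0
  (fun k lt_kN gk le_idx =>
     good_small_radius_success lt_kN (asboolW gk) (small k le_idx)).
have gain := sum_good_success_le large.
have compl : (\sum_(k < N) `[< good k >] + \sum_(k < N) ~~ `[< good k >] = N)%N.
  rewrite -big_split /= (eq_bigr (fun=> 1%N)).
    by rewrite sum_nat_const card_ord muln1.
  by move=> k _; case: asboolP.
have gap : (p - (p + t) + (p + t - p) = t)%N.
  by rewrite addKn -{1}(addn0 p) subnDl sub0n.
rewrite gap in count.
set G := (\sum_(k < N) `[< good k >])%N in compl *.
set M := (\sum_(k < N) ~~ `[< good k >])%N in compl count.
set W := (\sum_(k < N) [&& _, _ & _])%N in gain count.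
rewrite tauE -pmulrn; clearbody G M W.
have W_le : W%:R <= (f (x 0%N) - fstar) / h by rewrite ler_pdivlMr ?h_bound_gt0.
have count' : N%:R <= c.+1%:R * ((N%:R - G%:R) + W%:R) + t%:R :> R.
  have -> : N%:R - G%:R = M%:R :> R by rewrite -compl natrD; ring.
  by rewrite -natrD -natrM -natrD ler_nat.
have -> : 1 + c%:R = c.+1%:R :> R by rewrite -natr1 addrC.
have c1_gt0 : 0 < c.+1%:R^-1 :> R by rewrite invr_gt0.
have := ler_wpM2l (ltW c1_gt0) count'; rewrite mulrDr mulKf ?pnatr_eq0 //.
move: (_ / h) W_le (c.+1%:R^-1) => gain_h W_le c1.
lra.
Qed.

End Path.

(** * The hitting time *)

Section HittingTime.
Variables (R : realType) (d : nat) (f : 'cV[R]_d -> R) (eps : R).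
Variables (disp : measure_display) (Omega : measurableType disp).
Variable x : nat -> Omega -> 'cV[R]_d.

Lemma hitting_time_leP N w : (hitting_time f x eps w <= N%:R%:E)%E <->
  exists2 k : nat, (k <= N)%N & norm2 (gradient f (x k w)) <= eps.
Proof.
split=> [le_N|[k le_kN grad_le]]; last first.
  apply: (@le_trans _ _ (k%:R)%:E); last by rewrite lee_fin ler_nat.
  apply: ereal_inf_lbound; exists k => //=.
  by apply/bigmin_leP; right; exists ord_max.
apply: contrapT => no_hit; move: le_N; apply/negP; rewrite -ltNge.
apply: (@lt_le_trans _ _ (N.+1%:R)%:E); first by rewrite lte_fin ltr_nat.
apply: le_ereal_inf_tmp => _ [M /bigmin_leP hit <-].
rewrite lee_fin ler_nat ltnNge; apply/negP => le_MN; apply: no_hit.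
case: hit => [hit0|[k _ hit_k]]; first by exists 0%N.
by exists k => //; apply: leq_trans le_MN; rewrite -ltnS.
Qed.

Lemma measurable_hitting_time_le N : continuous (gradient f) ->
  (forall k, random_element (x k)) ->
  measurable [set w | (hitting_time f x eps w <= N%:R%:E)%E].
Proof.
move=> cg rx.
rewrite (_ : [set _ | _] = \bigcup_(k in [set k | (k <= N)%N])
    (x k @^-1` [set y | norm2 (gradient f y) <= eps])); last first.
  apply/seteqP; split=> w /=; first by move/hitting_time_leP.
  by move=> hit; apply/hitting_time_leP.
apply: bigcup_measurable => k _.
rewrite -[_ @^-1` _]setTI; apply: (rx k) => //; apply: borel_closed.
apply: (@preimage_closed _ _ (fun y => norm2 (gradient f y))
  [set r | r <= eps]); last exact: closed_le.
move=> y _; apply: (@continuous_comp _ _ _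
  (fun y => dotv (gradient f y) (gradient f y)) Num.sqrt);
  last exact: sqrt_continuous.
by apply: continuous_dotv => i; exact: continuous_gradient_coord.
Qed.

End HittingTime.

Theorem theorem4p5 (R : realType) (l d : nat) (f : 'cV[R]_d -> R)
    (L fstar C3 delta1 epsS : R)
    (c p : nat) (gamma1 gamma2 theta alphamax alpha0 C7 Bmax eps : R)
    (x0 : 'cV[R]_d)
    (disp : measure_display) (Omega : measurableType disp)
    (P : probability Omega R)
    (x : nat -> Omega -> 'cV[R]_d) (alpha : nat -> Omega -> R)
    (S : nat -> Omega -> 'M[R]_(l, d)) (B : nat -> Omega -> 'M[R]_d)
    (shat : nat -> Omega -> 'cV[R]_l) (N : nat)
    (deltaS := delta_hashing l C3 epsS)
    (h := h_bound l d c L Bmax theta C7 epsS eps gamma1 gamma2 alpha0)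
    (tau := tau_alpha l d L Bmax theta C7 epsS eps gamma1 gamma2 alpha0) :
  (0 < l < d)%N ->
  continuously_differentiable f ->
  0 <= L -> lipschitz_gradient L f ->
  is_minimum_value f fstar ->
  0 < C3 -> hashing_embedding l f C3 epsS ->
  0 < delta1 -> 0 < epsS < 3 / 4 ->
  deltaS < c%:R / c.+1%:R ^+ 2 ->
  0 < (rate c deltaS delta1)^-1 ->
  0 < gamma1 < 1 -> (0 < c)%N -> gamma2 = gamma1 ^- c ->
  0 < theta < 1 ->
  0 < alphamax -> (0 < p)%N -> alpha0 = alphamax * gamma1 ^+ p ->
  0 < C7 ->
  trust_region_run f gamma1 gamma2 theta alphamax C7 P x alpha S B shat
    x0 alpha0 ->
  0 <= Bmax -> (forall k w, opnorm2 (B k w) <= Bmax) ->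
  0 < eps ->
  (rate c deltaS delta1)^-1
    * ((f x0 - fstar) / h + tau%:~R / (1 + c%:R)) <= N%:R ->
  (P [set w | hitting_time f x eps w <= N%:R%:E]
    >= (1 - expR (- (delta1 ^+ 2 / 2 * (1 - deltaS) * N%:R)))%:E)%E.
Proof.
move=> _ df L_ge0 lip [_ f_ge] _ embed delta1_gt0.
move=> epsS01 deltaS_lt rate_gt0 gamma1_01 c_gt0 gamma2E theta01 alphamax_gt0.
move=> _ alpha0E C7_gt0 run Bmax_ge0 B_le eps_gt0 N_ge.
have deltaS_gt0 : 0 < deltaS by exact: expR_gt0.
rewrite /hashing_embedding -/deltaS in embed; clearbody deltaS.
(* c / (c + 1) ^ 2 <= 1 / 4 puts deltaS in the range where the embedding
   property is assumed. *)
have c_quarter : c%:R / c.+1%:R ^+ 2 <= 4^-1 :> R.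
  rewrite ler_pdivrMr ?exprn_gt0 // -(natr1 c).
  by have := sqr_ge0 (c%:R - 1 : R); lra.
have deltaS_lt4 : deltaS < 4^-1 := lt_le_trans deltaS_lt c_quarter.
have likely y : range (gradient f) y ->
    1 - deltaS <= stable_hashing (@preserves_norm R l d epsS y).
  apply: embed; rewrite deltaS_gt0 (lt_trans deltaS_lt4) //.
  by rewrite ltf_pV2 ?posrE // ltr_nat.
pose T := true_iteration f epsS x S.
have q01 : 0 <= 1 - deltaS <= 1.
  by clear -deltaS_gt0 deltaS_lt4; lra.
have [_ cg] := df.
have T_likely k H : history x alpha S B shat k H ->
    (1 - deltaS) * fine (P H) <= fine (P (T k `&` H)).
  move=> past_H; have mH := past_measurable run past_H.
  have mT : measurable (T k).
    apply: (past_measurable run (k := k.+1)); exact: past_true_iteration.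
  rewrite -lee_fin EFinM -!prE //; last exact: measurableI.
  apply: (true_iteration_likely cg run) => //.
  by clear -deltaS_lt4; lra.
have tail : fine (P (few_hits T 0 N ((1 - delta1) * (1 - deltaS) * N%:R)))
    <= expR (- (delta1 ^+ 2 / 2 * (1 - deltaS) * N%:R)).
  apply: (chernoff_lower_tail (F := history x alpha S B shat)) => //.
  - exact: past_measurable run.
  - exact: past_mono.
  - exact: past_setI.
  - exact: past_setD.
  - by move=> k; exact: past_true_iteration.
  - exact: ltW.
  - exact: past_setT.
set rare := few_hits _ _ _ _ in tail.
have mrare : measurable rare.
  apply: (@measurable_few_hits _ _ _ _ (history x alpha S B shat)).
   exact: (past_measurable run).
  exact: past_true_iteration.
have sub : ~` rare `<=` [set w | (hitting_time f x eps w <= N%:R%:E)%E].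
  move=> w not_rare /=; apply: contrapT => no_hit; apply: not_rare.
  have [x_w alpha_w] := run_init run w.
  have grad_gt k : (k < N)%N -> eps < norm2 (gradient f (x k w)).
    move=> lt_kN; rewrite ltNge; apply/negP => hit; apply: no_hit.
    by apply/hitting_time_leP; exists k => //; exact: ltnW.
  have := true_iterations_le df L_ge0 lip f_ge epsS01 gamma1_01 c_gt0 gamma2E
    theta01 alphamax_gt0 alpha0E C7_gt0 Bmax_ge0 eps_gt0 alpha_w
    (run_psd run ^~ w) (B_le ^~ w) (run_step run ^~ w) (run_update run ^~ w)
    grad_gt.
  rewrite x_w -/h -/tau /rare /few_hits /= => true_le.
  have c1_ge0 : c%:R / c.+1%:R ^+ 2 <= c.+1%:R^-1 :> R.
    by rewrite ler_pdivrMr ?exprn_gt0 // expr2 mulKf ?pnatr_eq0 // ler_nat.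
  have N_ge0 : 0 <= N%:R :> R by [].
  rewrite invr_gt0 in rate_gt0; rewrite mulrC ler_pdivrMr // in N_ge.
  apply: le_trans true_le _; apply: le_trans (lerD (lexx _) N_ge) _.
  have := ler_wpM2r N_ge0 c1_ge0; rewrite /rate.
  move: (c%:R / _) (c.+1%:R^-1) (N%:R : R) => c_ratio c1 n.
  by clear; lra.
have rx k : random_element (x k) by case: (run_random run k).
have mhit := measurable_hitting_time_le eps N cg rx.
have hit_ge :
    (P (~` rare) <= P [set w | (hitting_time f x eps w <= N%:R%:E)%E])%E.
  by apply: le_measure; rewrite ?inE //; exact: measurableC.
apply: le_trans hit_ge.
by rewrite probability_setC // prE // -EFinB lee_fin lerB.
Qed.
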